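(* Let $A\in\mathrm{SL}(4,\mathbb{C})$ have characteristic polynomial $\chi_A(x)=x^4-c_3x^3+c_2x^2-c_1x+1$. If $c_3\neq\overline{c_1}$ or $c_2\notin\mathbb{R}$, then the characteristic polynomial of $A$ is not $c$-reciprocal. Suppose now that $c_3=\overline{c_1}$ and $c_2\in\mathbb{R}$. Then: (1) if the sequence $\{\operatorname{tr}(A^n)\}_{n\in\mathbb{N}}$ is bounded, then $A$ is $c$-reversible; (2) if this trace sequence is unbounded and the minimal polynomial of $A$ has degree different from $3$, then $A$ is $c$-reversible; (3) suppose the trace sequence is unbounded and the minimal polynomial of $A$ has degree $3$. (a) If $\operatorname{tr}(A)=x+iy$ with $x,y\in\mathbb{R}$, $x\neq 0$, $y\neq 0$, then $A$ is $c$-reversible. (b) If $\operatorname{tr}(A)\in\mathbb{R}$, then $A$ is $c$-reversible if and only if $c_2\neq \frac{c_3^2}{4}+2$; and if $\operatorname{tr}(A)$ is purely imaginary, then $A$ is $c$-reversible if and only if $c_2\neq\frac{c_3^2}{4}-2$.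
   Context: For a matrix $g$, $\overline{g}$ denotes its entrywise complex conjugate. $g\in\mathrm{SL}(n,\mathbb{C})$ is $c$-reversible if there exists $h\in\mathrm{SL}(n,\mathbb{C})$ with $hgh^{-1}=\overline{g}^{-1}$. A polynomial with nonzero roots is $c$-reciprocal if for every root $\lambda$, $\overline{\lambda}^{-1}$ is also a root with the same multiplicity. *)

(* Defs.v *)
From mathcomp Require Import all_boot all_algebra.
From mathcomp Require Import complex.
From mathcomp Require Import Rstruct.
Set Implicit Arguments. Unset Strict Implicit. Unset Printing Implicit Defensive.
Import GRing.Theory Num.Theory.
Local Open Scope ring_scope.

Definition C : Type := complex Rdefinitions.R.

Definition conj_mx {m n : nat} (g : 'M[C]_(m, n)) : 'M[C]_(m, n) :=
  map_mx (@Num.Def.conjC _) g.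

Definition c_reversible {n : nat} (g : 'M[C]_n) : Prop :=
  exists h : 'M[C]_n, \det h = 1 /\ h *m g *m invmx h = invmx (conj_mx g).

(* A polynomial (with nonzero roots) is c-reciprocal: for every root lambda,
   (conj lambda)^-1 is also a root, with the same multiplicity. *)
Definition c_reciprocal (p : {poly C}) : Prop :=
  forall l : C, root p l ->
    root p ((Num.Def.conjC l)^-1) /\ mup ((Num.Def.conjC l)^-1) p = mup l p.

Definition trace_powers_bounded {n : nat} (A : 'M[C]_n) : Prop :=
  exists M : Rdefinitions.R, forall k : nat, `|\tr (A ^+ k)| <= (M%:C)%C.

(* Main.v *)
(** Write [s z = 1 / conj z].  [A] is c-reversible iff it is similar to
    [B = (conj A)^-1], that is, iff it preserves a nondegenerate sesquilinear
    form; the characteristic roots of [B] are the images under [s] of those of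
    [A], and the conditions on the [c_i] say that this multiset is [s]-stable.
    Splitting off a cyclic subspace of maximal dimension, [A] is similar to
    [diag (C, A')] with [C] cyclic and [char_poly C = mxminpoly A].  Cyclic
    matrices with the same characteristic polynomial are similar, so both
    blocks preserve a form as soon as their root multisets are [s]-stable.  In
    dimension 4 this fails only if [A'] is 1x1 with an entry [c] such that
    [s c <> c]; then the roots are [c, c, s c, s c], the minimal polynomial is
    not [s]-stable, and [det A = 1] forces [c * s c = 1] or [-1], which are the
    real and the purely imaginary cases of the theorem. *)

Require Import Defs.
From mathcomp Require Import all_boot all_order all_algebra.
From mathcomp Require Import complex.
From mathcomp Require Import Rstruct.
From mathcomp Require boolp.
From mathcomp Require Import ring zify.
Set Implicit Arguments.
Unset Strict Implicit.
Unset Printing Implicit Defensive.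
Import Order.TTheory GRing.Theory Num.Theory.
Local Open Scope ring_scope.

(** * Cyclic vectors and Krylov matrices *)

(** Finitely many proper subspaces cannot cover a space over an infinite field. By induction, a
    vector good for [s] is moved along a direction [e_i] outside the kernel of the new matrix. *)
Lemma avoid_kernels (F : numFieldType) (n p : nat) (s : seq 'M[F]_(n, p)) :
  all (fun M => M != 0) s -> exists v : 'rV_n, all (fun M => v *m M != 0) s.
Proof.
elim: s => [|M s IHs] /=; first by exists 0.
case/andP=> M0 /IHs [v vs].
have [i Mi0] : exists i, row i M != 0.
  by apply/existsP; apply: contraNT M0; rewrite negb_exists => /forallP H;
     apply/eqP/row_matrixP => i; rewrite row0; apply/eqP; move: (H i); rewrite negbK.
(* For all but finitely many t, the vector v + t e_i works. *)
have good : exists T : nat, forall t, (T <= t)%N ->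
    all (fun N => (v + t%:R *: delta_mx 0 i) *m N != 0) (M :: s).
  (* No matrix in the list vanishes on both [v] and [e_i], so each excludes at most one [t]. *)
  have : all (fun N => (v *m N != 0) || (row i N != 0)) (M :: s).
    rewrite /= Mi0 orbT /=; apply: sub_all vs => N ->//.
  elim: (M :: s) => [|N r IHr] /=; first by exists 0%N.
  case/andP=> HN /IHr [T HT].
  have E t : (v + t%:R *: delta_mx 0 i) *m N = v *m N + t%:R *: row i N.
    by rewrite mulmxDl -scalemxAl -rowE.
  have [T' HT'] : exists T', forall t, (T' <= t)%N -> v *m N + t%:R *: row i N != 0.
    have [r0|r0] := eqVneq (row i N) 0.
      by exists 0%N => t _; rewrite r0 scaler0 addr0; rewrite r0 eqxx orbF in HN.
    have [[t Ht]|none] := boolp.pselect (exists t : nat, v *m N + t%:R *: row i N = 0).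
      exists t.+1 => u tu; apply/eqP => Hu.
      have : (u%:R - t%:R : F) *: row i N = 0.
        by rewrite scalerBl -[X in X - _](addKr (v *m N)) Hu addr0 -opprD Ht oppr0.
      move/eqP; rewrite scaler_eq0 (negPf r0) orbF subr_eq0 eqr_nat => /eqP ut.
      by rewrite ut ltnn in tu.
    by exists 0%N => t _; apply/eqP => Ht; apply: none; exists t.
  exists (maxn T T') => t; rewrite geq_max => /andP[H1 H2] /=.
  by rewrite HT // E HT'.
by case: good => T /(_ T (leqnn T)) HT; exists (v + T%:R *: delta_mx 0 i).
Qed.

(** Take [v] outside the kernels of [(m / (X - z))(A)], for [z] a root of the minimal polynomial
    [m]. If [q(A)] kills [v], so does [g(A)] with [g = gcd(q, m)]; were [g] a proper divisor of [m],
    it would divide some [m / (X - z)], which would then kill [v] too. *)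
Lemma cyclic_vector (F : numClosedFieldType) (n : nat) (A : 'M[F]_n.+1) :
  exists v : 'rV_n.+1, forall q, v *m horner_mx A q = 0 -> mxminpoly A %| q.
Proof.
set m := mxminpoly A.
have m0 : m != 0 by rewrite monic_neq0 ?mxminpoly_monic.
have [r Em] := closed_field_poly_normal m.
rewrite (monicP (mxminpoly_monic A)) scale1r in Em.
have /avoid_kernels[v /allP vP] :
    all (fun M => M != 0) [seq horner_mx A (m %/ ('X - z%:P)) | z <- r].
  apply/allP => M /mapP[z zr ->]; rewrite -dvd_mxminpoly -/m.
  have zm : 'X - z%:P %| m by rewrite dvdp_XsubCl Em root_prod_XsubC.
  apply/negP => /dvdp_leq; rewrite dvdp_div_eq0 // m0 => /(_ isT).
  rewrite size_divp ?polyXsubC_eq0 // size_XsubC leqNgt subn1 prednK ?leqnn //.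
  by rewrite lt0n size_poly_eq0.
exists v => q vq; set g := gcdp q m.
have vg : v *m horner_mx A g = 0.
  have [[a b] /eqpf_eq /= [c c0 Eab]] := Bezoutp q m.
  have -> : g = c^-1 *: (a * q + b * m) by rewrite Eab scalerA mulVf ?scale1r.
  rewrite horner_mxZ rmorphD !rmorphM /= -/m mx_root_minpoly mulr0 addr0.
  rewrite [_ a * _]comm_horner_mx2 -scalemxAr mulmxA.
  by rewrite vq mul0mx scaler0.
have [gm|] := eqVneq (size (m %/ g)) 1%N.
  have Eg : m = m %/ g * g by rewrite divpK // dvdp_gcdr.
  have /eqP/size_poly1P [c c0 Ec] : size (m %/ g) = 1%N by [].
  by rewrite Eg Ec mul_polyC dvdpZl // dvdp_gcdl.
move/closed_rootP => [z zg].
have gm : g %| m by apply: dvdp_gcdr.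
have Eg : m = m %/ g * g by rewrite divpK.
have zr : z \in r by rewrite -root_prod_XsubC -Em Eg rootM zg.
have /vP /negP[] : horner_mx A (m %/ ('X - z%:P)) \in
    [seq horner_mx A (m %/ ('X - z%:P)) | z <- r] by apply: map_f.
have /dvdpP [k Ek] : 'X - z%:P %| m %/ g by rewrite dvdp_XsubCl.
rewrite Eg Ek mulrAC mulpK ?polyXsubC_eq0 // mulrC rmorphM /=.
by rewrite mulmxA vg mul0mx.
Qed.

Section Krylov.
Variables (F : fieldType) (n : nat) (A : 'M[F]_n.+1) (v : 'rV[F]_n.+1) (d : nat).

Definition krylov : 'M_(d, n.+1) := \matrix_(i < d) (v *m A ^+ i).

(* The companion matrix of [p]; the size of [companionmx p] is [(size p).-1],
   which is only propositionally equal to [d]. *)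
Definition shift_mx (p : {poly F}) : 'M_d :=
  \matrix_(i < d) (poly_rV ('X^(i.+1) - (if i.+1 == d then p else 0)) : 'rV[F]_d).

Lemma mul_krylov (u : 'rV_d) : u *m krylov = v *m horner_mx A (rVpoly u).
Proof.
rewrite mulmx_sum_row /rVpoly poly_def rmorph_sum mulmx_sumr.
apply: eq_bigr => i _; rewrite rowK /= horner_mxZ rmorphXn /= horner_mx_X.
by rewrite -scalemxAr insubT // => H; congr (u 0 _ *: _); apply: val_inj.
Qed.

Lemma krylov_shift (p : {poly F}) : p \is monic -> size p = d.+1 ->
  horner_mx A p = 0 -> krylov *m A = shift_mx p *m krylov.
Proof.
move=> pm sp pA; apply/row_matrixP => i; rewrite !row_mul !rowK mul_krylov.
(* The row polynomial must have degree below [d] to survive the encoding as a row vector; in the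
   last row the leading terms of [X^d] and [p] cancel. *)
rewrite poly_rV_K; last first.
  case: ifP => [/eqP Ei|/negbT Ei]; last first.
    by rewrite subr0 size_polyXn ltn_neqAle Ei ltn_ord.
  apply/leq_sizeP => j; rewrite leq_eqVlt Ei coefB coefXn => /orP[/eqP<-|dj].
    have -> : p`_d = lead_coef p by rewrite lead_coefE sp.
    by rewrite (monicP pm) eqxx subrr.
  by rewrite gtn_eqF // nth_default ?subr0 // sp.
rewrite -mulmxA -[_ *m A]/(_ * A) -exprSr rmorphB /= rmorphXn /= horner_mx_X.
by case: ifP => _; rewrite ?pA ?rmorph0 subr0.
Qed.

End Krylov.

(** A linear relation between the rows is a polynomial of degree below [d] that kills [v], hence a
    multiple of the longer minimal polynomial. *)
Lemma krylov_free (F : fieldType) (n : nat) (A : 'M[F]_n.+1) (v : 'rV_n.+1) (d : nat) :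
    (forall q, v *m horner_mx A q = 0 -> mxminpoly A %| q) ->
  (d < size (mxminpoly A))%N -> row_free (krylov A v d).
Proof.
move=> vA dm; apply: inj_row_free => u; rewrite mul_krylov => /vA mu.
rewrite -[u]rVpolyK; have [->|u0] := eqVneq (rVpoly u) 0.
  by rewrite linear0.
have := leq_trans dm (dvdp_leq u0 mu).
by rewrite ltnNge size_poly.
Qed.

(** * Splitting off a cyclic block *)

Lemma horner_mx_tr (R : comNzRingType) (n : nat) (A : 'M[R]_n.+1) (p : {poly R}) :
  horner_mx A^T p = (horner_mx A p)^T.
Proof.
elim/poly_ind: p => [|p c IHp]; first by rewrite !rmorph0 trmx0.
rewrite !rmorphD !rmorphM /= !horner_mx_X !horner_mx_C IHp linearD /= tr_scalar_mx.
have -> : horner_mx A p * A = A *m horner_mx A p by apply: comm_horner_mx.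
by rewrite trmx_mul.
Qed.

(** The stable complement of the cyclic subspace [K] comes from duality: a functional [f] is chosen
    so that the pairing of the vectors [v A^i] with the functionals [A^j f] is nondegenerate, and
    the complement is the common kernel of these functionals. *)
Lemma cyclic_decomposition (F : numClosedFieldType) (n : nat) (A : 'M[F]_n.+1) :
  exists d e (C : 'M_d.+1) (A' : 'M_e) (P : 'M_(d.+1 + e, n.+1)),
  [/\ (d.+1 + e)%N = n.+1, row_free P, P *m A = block_mx C 0 0 A' *m P,
      char_poly C = mxminpoly A & mxminpoly C = mxminpoly A].
Proof.
have [v vA] := cyclic_vector A.
set m := mxminpoly A in vA *.
have mm : m \is monic by apply: mxminpoly_monic.
have [d sm] : exists d, size m = d.+2.
  rewrite /m size_mxminpoly; have := mxminpoly_nonconstant A.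
  by case: (degree_mxminpoly A) => // d _; exists d.
have Am : horner_mx A m = 0 by apply: mx_root_minpoly.
pose K := krylov A v d.+1.
have Kf : row_free K by apply: krylov_free; rewrite -/m ?sm.
have KA := krylov_shift v mm sm Am; rewrite -/K in KA.
have Kst : stablemx K A by rewrite KA submxMl.
have [f Kphi] : exists f : 'cV_n.+1, K *m f = delta_mx ord_max 0.
  have [B KB] := row_freeP Kf.
  by exists (B *m delta_mx ord_max 0); rewrite mulmxA KB mul1mx.
(* On [v r(A)] with [deg r <= d], the functional [f] reads off the coefficient of [X^d]. *)
have vf (r : {poly F}) : (size r <= d.+1)%N -> v *m horner_mx A r *m f = (r`_d)%:M.
  move=> sr; rewrite -[r in horner_mx _ r](poly_rV_K sr) -mul_krylov -mulmxA -/K Kphi.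
  by apply/rowP => i; rewrite -colE !mxE (ord1 i) eqxx.
(* The complement: W is the set of vectors killed by all the functionals A^j f. *)
pose L := (krylov A^T f^T d.+1)^T.
have AL : A *m L = L *m (shift_mx d.+1 m)^T.
  apply: trmx_inj; rewrite !trmx_mul !trmxK (krylov_shift _ mm sm) //.
  by rewrite horner_mx_tr Am trmx0.
have KLf : row_free (K *m L).
  apply: inj_row_free => u; rewrite mulmxA mul_krylov => uKL.
  apply/eqP; apply/negPn/negP => u0; set q := rVpoly u in uKL.
  have q0 : q != 0.
    by apply: contraNneq u0 => q0; rewrite -[u]rVpolyK -/q q0 linear0.
  have sq : (size q <= d.+1)%N by apply: size_poly.
  (* A nonzero [q] orthogonal to all [A^j f] is shifted by a power of [X] to degree exactly [d]; [f]
     then returns its leading coefficient, which would be 0. *)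
  have jd : (d.+1 - size q < d.+1)%N by rewrite ltn_subrL size_poly_gt0 q0.
  have sqX : size (q * 'X^(d.+1 - size q)) = d.+1 by rewrite size_mulXn ?subnK.
  have : (q * 'X^(d.+1 - size q))`_d = 0.
    have := vf (q * 'X^(d.+1 - size q)); rewrite sqX leqnn => /(_ isT).
    rewrite rmorphM /= rmorphXn /= horner_mx_X mulmxA -mulmxA.
    have -> : A ^+ (d.+1 - size q) *m f = col (Ordinal jd) L.
      rewrite -tr_row rowK trmx_mul trmxK; congr (_ *m _).
      rewrite -(horner_mx_X A^T) -rmorphXn /= horner_mx_tr rmorphXn /= horner_mx_X.
      by rewrite trmxK.
    rewrite colE mulmxA uKL mul0mx => /rowP/(_ 0); rewrite !mxE => /esym.
    by rewrite eqxx mulr1n.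
  have := lead_coefE (q * 'X^(d.+1 - size q)); rewrite sqX /= => <- /eqP.
  by rewrite lead_coef_eq0 -size_poly_eq0 sqX.
pose W := row_base (kermx L).
have Wf : row_free W by apply: row_base_free.
have Wst : stablemx W A.
  rewrite stablemx_row_base; apply/sub_kermxP.
  by rewrite -mulmxA AL mulmxA mulmx_ker mul0mx.
have WL : W *m L = 0 by apply/sub_kermxP; rewrite eq_row_base.
have Pf : row_free (col_mx K W).
  apply: inj_row_free => u; rewrite -[u]hsubmxK mul_row_col => uP.
  have u1 : lsubmx u = 0.
    apply: (row_free_inj KLf); rewrite mul0mx.
    have /(congr1 (mulmx^~ L)) := uP.
    by rewrite mul0mx mulmxDl -(mulmxA _ K) -(mulmxA _ W) WL mulmx0 addr0.
  rewrite u1 mul0mx add0r in uP.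
  have -> : rsubmx u = 0 by apply: (row_free_inj Wf); rewrite uP mul0mx.
  by rewrite u1 row_mx0.
exists d, (\rank (kermx L)), (conjmx K A), (conjmx W A), (col_mx K W).
(* The minimal polynomial of the block kills [v], the first row of [K], so [m] divides it; comparing
   sizes, the characteristic polynomial of the block is [m] as well. *)
have mC : m %| mxminpoly (conjmx K A).
  apply: vA.
  have : K *m horner_mx A (mxminpoly (conjmx K A)) = 0.
    rewrite -(mulmxKpV (horner_mx_stable _ Kst)) -[_ *m pinvmx K]/(conjmx _ _).
    by rewrite -horner_mx_conj // mx_root_minpoly mul0mx.
  by move/row_matrixP/(_ 0); rewrite row_mul rowK expr0 mulmx1 row0.
have cC : m %| char_poly (conjmx K A) := dvdp_trans mC (mxminpoly_dvd_char _).
have EcC : char_poly (conjmx K A) = m.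
  apply/esym/eqP; rewrite -eqp_monic ?char_poly_monic //.
  by rewrite -dvdp_size_eqp // sm size_char_poly.
split => //.
- have rL : \rank L = d.+1.
    apply/eqP; rewrite eqn_leq rank_leq_col /=.
    by move: KLf; rewrite -row_leq_rank => /leq_trans -> //; apply: mxrankM_maxr.
  rewrite mxrank_ker rL subnKC //.
  by move: Kf; rewrite -row_leq_rank => /leq_trans -> //; apply: rank_leq_col.
- rewrite mul_col_mx mul_block_col !mul0mx add0r addr0.
  by rewrite /conjmx !mulmxKpV.
apply/eqP; rewrite -eqp_monic ?mxminpoly_monic // /eqp mC andbT.
by rewrite -EcC mxminpoly_dvd_char.
Qed.

(** * Similarity to the inverse of the conjugate *)

(* [g] preserves the nondegenerate sesquilinear form of Gram matrix [h]. *)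
Definition conj_isometry (F : numClosedFieldType) (n : nat) (g : 'M[F]_n) : Prop :=
  exists2 h : 'M_n, h \in unitmx & map_mx Num.conj g *m h *m g = h.

(** The dimensions [m] and [n] are kept apart because [d.+1 + e] and [n.+1] in the decomposition are
    only propositionally equal. *)
Lemma conj_isometry_similar (F : numClosedFieldType) (m n : nat)
    (P : 'M[F]_(m, n)) (A : 'M_n) (D : 'M_m) :
  m = n -> row_free P -> P *m A = D *m P -> conj_isometry D -> conj_isometry A.
Proof.
move=> mn; subst m; rewrite row_free_unit => Pu PA [h hu hD].
have cP : map_mx Num.conj P \in unitmx by rewrite map_unitmx.
exists (invmx (map_mx Num.conj P) *m h *m P); first by rewrite !unitmx_mul unitmx_inv cP hu Pu.
have cPA : map_mx Num.conj A *m invmx (map_mx Num.conj P) =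
           invmx (map_mx Num.conj P) *m map_mx Num.conj D.
  apply: (canRL (mulKmx cP)); rewrite mulmxA -map_mxM PA map_mxM.
  by rewrite mulmxK.
by rewrite !mulmxA cPA -(mulmxA _ P A) PA mulmxA -(mulmxA _ _ h) -(mulmxA _ _ D) hD.
Qed.

Lemma conj_isometry_block (F : numClosedFieldType) (m n : nat) (C : 'M[F]_m) (D : 'M_n) :
  conj_isometry C -> conj_isometry D -> conj_isometry (block_mx C 0 0 D).
Proof.
move=> [h hu hC] [k ku kD]; exists (block_mx h 0 0 k).
  by rewrite block_diag_mx_unit hu.
rewrite map_block_mx !map_mx0 !mulmx_block.
by rewrite !(mulmx0, mul0mx, add0r, addr0) hC kD.
Qed.

Lemma conj_isometry_scalar (F : numClosedFieldType) (n : nat) (c : F) :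
  c^* * c = 1 -> conj_isometry (c%:M : 'M_n).
Proof.
move=> cc; exists 1%:M; first exact: unitmx1.
by rewrite map_scalar_mx mulmx1 -scalar_mxM cc.
Qed.

(** In the Krylov bases of cyclic vectors, both matrices become the companion matrix of the common
    characteristic polynomial. *)
Lemma cyclic_similar (F : numClosedFieldType) (n : nat) (A B : 'M[F]_n.+1) :
    mxminpoly A = char_poly A -> mxminpoly B = char_poly B ->
    char_poly A = char_poly B ->
  exists2 h, h \in unitmx & h *m A = B *m h.
Proof.
move=> mA mB AB.
have [v vA] := cyclic_vector A; have [w wB] := cyclic_vector B.
have Ku : krylov A v n.+1 \in unitmx.
  by rewrite -row_free_unit krylov_free // mA size_char_poly.
have Lu : krylov B w n.+1 \in unitmx.
  by rewrite -row_free_unit krylov_free // mB size_char_poly.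
have KA := krylov_shift v (char_poly_monic A) (size_char_poly A) (Cayley_Hamilton A).
have LB := krylov_shift w (char_poly_monic B) (size_char_poly B) (Cayley_Hamilton B).
exists (invmx (krylov B w n.+1) *m krylov A v n.+1).
  by rewrite unitmx_mul unitmx_inv Lu.
rewrite -mulmxA KA; apply: (can_inj (mulKmx Lu)).
by rewrite mulKVmx // mulmxA LB -AB -mulmxA mulKVmx.
Qed.

(** If [q] of degree [k] kills the inverse of [A], then the reversed polynomial [r = X^k q(1/X)]
    kills [A]. It is nonzero because [r(0)] is the leading coefficient of [q]. *)
Lemma size_mxminpoly_inv (F : fieldType) (n : nat) (A : 'M[F]_n.+1) :
  A \in unitmx -> (size (mxminpoly A) <= size (mxminpoly (invmx A)))%N.
Proof.
move=> Au; set q := mxminpoly (invmx A).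
have q0 : q != 0 by rewrite monic_neq0 ?mxminpoly_monic.
pose k := (size q).-1; have sq : size q = k.+1 by rewrite /k prednK // size_poly_gt0.
pose r := \poly_(i < k.+1) q`_(k - i).
have r0 : r != 0.
  apply/eqP => /(congr1 (fun p : {poly F} => p`_0)).
  rewrite coef_poly subn0 coef0 -lead_coefE (monicP (mxminpoly_monic _)).
  by apply/eqP; rewrite oner_eq0.
rewrite sq; apply: leq_trans (size_poly k.+1 (fun i => q`_(k - i))).
apply: dvdp_leq => //; rewrite dvd_mxminpoly.
have -> : horner_mx A r = A ^+ k *m horner_mx (invmx A) q.
  rewrite -[q in RHS]coefK sq /r !poly_def !rmorph_sum /= mulmx_sumr.
  rewrite (reindex_inj rev_ord_inj) /=; apply: eq_bigr => i _.
  rewrite subSS subKn -1?ltnS // !horner_mxZ !rmorphXn /= !horner_mx_X.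
  rewrite -scalemxAr; congr (_ *: _).
  have ik : (i <= k)%N by rewrite -ltnS.
  rewrite -[X in A ^+ X *m _](subnK ik) exprD.
  rewrite -[_ * A ^+ i]/(_ *m A ^+ i) -mulmxA -[A ^+ i *m _]/(A ^+ i * A^-1 ^+ i).
  by rewrite -exprMn_comm ?divrr ?expr1n ?mulmx1 //; apply/commrV.
by rewrite mx_root_minpoly mulmx0.
Qed.

Lemma mxminpoly_eq_char (F : fieldType) (n : nat) (A : 'M[F]_n.+1) :
  (n.+1 < size (mxminpoly A))%N -> mxminpoly A = char_poly A.
Proof.
move=> sm; apply/eqP; rewrite -eqp_monic ?char_poly_monic ?mxminpoly_monic //.
rewrite -dvdp_size_eqp ?mxminpoly_dvd_char // eqn_leq dvdp_leq ?mxminpoly_dvd_char //.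
  by rewrite size_char_poly.
by rewrite monic_neq0 // char_poly_monic.
Qed.

(** Conjugation and inversion do not shorten the minimal polynomial, so [B] is cyclic too; equal
    characteristic polynomials then make [A] and [B] similar. *)
Lemma conj_isometry_cyclic (F : numClosedFieldType) (n : nat) (A : 'M[F]_n.+1) :
    A \in unitmx -> mxminpoly A = char_poly A ->
    char_poly (invmx (map_mx Num.conj A)) = char_poly A -> conj_isometry A.
Proof.
move=> Au mA cA; set B := invmx _ in cA.
have cu : map_mx Num.conj A \in unitmx by rewrite map_unitmx.
have mB : mxminpoly B = char_poly B.
  apply: mxminpoly_eq_char; apply: leq_trans (size_mxminpoly_inv cu).
  by rewrite mxminpoly_map size_map_poly mA size_char_poly.
have [h hu hA] := cyclic_similar mA mB (esym cA).
by exists h => //; rewrite -mulmxA hA mulmxA mulmxV // mul1mx.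
Qed.

(** * Reflection in the unit circle and characteristic roots *)

(** The map [s] of the overview. Since [0^-1 = 0], it also fixes 0, so a fixed point is known to be
    unimodular only once it is nonzero. *)
Definition cinv {F : numClosedFieldType} (z : F) : F := (z^*)^-1.

Lemma cinvK (F : numClosedFieldType) : involutive (@cinv F).
Proof. by move=> z; rewrite /cinv fmorphV invrK /= conjCK. Qed.

Lemma cinv_inj (F : numClosedFieldType) : injective (@cinv F).
Proof. exact: inv_inj (@cinvK F). Qed.

Lemma horner_char_poly (F : fieldType) (n : nat) (A : 'M[F]_n) (x : F) :
  (char_poly A).[x] = \det (x%:M - A).
Proof.
rewrite -horner_evalE -det_map_mx; congr (\det _).
by apply/matrixP => i j; rewrite !mxE /= horner_evalE !hornerE hornerMn hornerX.
Qed.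

(** For [x != 0], [det B * det (x - B^-1) = det (x B - 1) = (-x)^n det (x^-1 - B)], and the last
    determinant is known from the roots of [B]. *)
Lemma char_poly_conj_inv (F : numClosedFieldType) (n : nat) (A : 'M[F]_n) (s : seq F) :
    A \in unitmx -> char_poly A = \prod_(z <- s) ('X - z%:P) ->
  char_poly (invmx (map_mx Num.conj A)) = \prod_(z <- map cinv s) ('X - z%:P).
Proof.
move=> Au As; set B := map_mx _ A.
have Bu : B \in unitmx by rewrite map_unitmx.
pose t := map Num.conj s.
have Bt : char_poly B = \prod_(z <- t) ('X - z%:P).
  rewrite -map_char_poly As rmorph_prod big_map; apply: eq_bigr => z _.
  by rewrite rmorphB /= map_polyX map_polyC.
have -> : map cinv s = map GRing.inv t by rewrite -map_comp.
have st : size t = n.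
  by apply/eqP; rewrite -eqSS -(size_prod_XsubC t id) -Bt size_char_poly.
have detB : \det B = \prod_(z <- t) z.
  rewrite -[LHS](signrMK n) -char_poly_det -horner_coef0 Bt horner_prod -st.
  elim: (t) => [|z r IHr]; first by rewrite !big_nil mulr1.
  by rewrite !big_cons -IHr exprS mulrACA hornerXsubC sub0r mulN1r opprK.
have dB : \det B != 0 by rewrite -unitfE -unitmxE.
have t0 : all (fun z => z != 0) t.
  by apply/allP => z zt; move: dB; rewrite detB; apply: contraNneq => z0;
     rewrite (big_rem z) //= z0 mul0r.
(* The factor ['X] makes the point where the two polynomials are assumed to differ nonzero. *)
apply/eqP; rewrite -subr_eq0; apply/negPn/negP => D0.
have /closed_nonrootP [x] :
    'X * (char_poly (invmx B) - \prod_(z <- map GRing.inv t) ('X - z%:P)) != 0.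
  by rewrite mulf_neq0 ?polyX_eq0.
rewrite rootM rootX negb_or => /andP[x0]; case/negP.
rewrite /root !hornerE subr_eq0 horner_char_poly horner_prod big_map.
apply/eqP/(mulfI dB); rewrite -det_mulmx mulmxBr mulmxV // scalar_mxC mul_scalar_mx.
have -> : x *: B - 1%:M = (- x) *: ((x^-1)%:M - B).
  by rewrite scalerBr scale_scalar_mx mulNr divff // scaleNr opprK raddfN addrC.
rewrite detZ -horner_char_poly Bt horner_prod detB -st.
elim: (t) t0 => [|z r IHr]; first by rewrite !big_nil !mulr1.
rewrite /= => /andP[z0 /IHr E]; rewrite !big_cons mulrACA -E exprS mulrACA.
congr (_ * _); rewrite !hornerXsubC !mulrBr mulNr !divff //; ring.
Qed.

Lemma similar_unit_char (F : fieldType) (m n : nat)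
    (P : 'M[F]_(m, n)) (A : 'M_n) (D : 'M_m) :
    m = n -> row_free P -> P *m A = D *m P ->
  (D \in unitmx) = (A \in unitmx) /\ char_poly D = char_poly A.
Proof.
move=> mn; subst m; rewrite row_free_unit => Pu PA.
have dP : \det P != 0 by rewrite -unitfE -unitmxE.
split.
  have /(congr1 determinant) := PA; rewrite !det_mulmx mulrC => /(mulIf dP) AD.
  by rewrite !unitmxE AD.
have /(congr1 (map_mx (@polyC F))) := PA; rewrite !map_mxM /= => PA'.
have : map_mx (@polyC F) P *m char_poly_mx A = char_poly_mx D *m map_mx (@polyC F) P.
  by rewrite /char_poly_mx mulmxBr mulmxBl PA' scalar_mxC.
move/(congr1 determinant); rewrite !det_mulmx mulrC => /mulIf E; apply/esym/E.
by rewrite det_map_mx polyC_eq0.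
Qed.

Lemma trig_mx_exp (R : comNzRingType) (n : nat) (T : 'M[R]_n.+1) (k : nat) :
    is_trig_mx T ->
  is_trig_mx (T ^+ k) /\ forall i, (T ^+ k) i i = T i i ^+ k.
Proof.
move=> /is_trig_mxP T0; elim: k => [|k [/is_trig_mxP IH1 IH2]].
  by split=> [|i]; [exact: scalar_mx_is_trig | rewrite !mxE eqxx].
split=> [|i].
  apply/is_trig_mxP => i j ij; rewrite exprS mxE big1 // => l _.
  have [il|li] := ltnP i l; first by rewrite T0 ?mul0r.
  by rewrite IH1 ?mulr0 // (leq_ltn_trans li).
rewrite exprS mxE (bigD1 i) //= IH2 -exprS big1 ?addr0 // => l li.
have [il|li'] := ltnP i l; first by rewrite T0 ?mul0r.
by rewrite IH1 ?mulr0 // ltn_neqAle val_eqE li.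
Qed.

(** Schur triangularization reduces this to the diagonal of a triangular matrix, whose entries are
    the characteristic roots. *)
Lemma trace_exp (F : numClosedFieldType) (n : nat) (A : 'M[F]_n.+1) (s : seq F) (k : nat) :
    char_poly A = \prod_(z <- s) ('X - z%:P) ->
  \tr (A ^+ k) = \sum_(z <- s) z ^+ k.
Proof.
move=> As; have [P /unitarymx_unit Pu] := Schur A (ltn0Sn n).
move=> PAtrig.
have [T Ttrig PA] : exists2 T, is_trig_mx T & P *m A = T *m P.
  by exists (conjmx P A); rewrite // mulmxKpV // stablemx_unit.
have PAk : P *m A ^+ k = T ^+ k *m P.
  elim: k => [|k IH]; first by rewrite mulmx1 mul1mx.
  by rewrite exprSr [_ * A]/(_ *m A) mulmxA IH -mulmxA PA mulmxA exprSr.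
have -> : A ^+ k = invmx P *m (T ^+ k *m P) by rewrite -PAk mulKmx.
rewrite mxtrace_mulC mulmxK //.
have [_ Tk] := trig_mx_exp k Ttrig.
have : perm_eq [seq T i i | i <- enum 'I_n.+1] s.
  apply: prod_XsubC_eq; rewrite -As big_map big_enum -char_poly_trig //.
  by have [] := @similar_unit_char _ _ _ P A T erefl; rewrite ?row_free_unit.
move/(perm_big _) <-; rewrite big_map big_enum.
by apply: eq_bigr => i _; rewrite Tk.
Qed.

(** * Root multisets stable under [cinv] *)

Section Conjugate.
Variable F : numClosedFieldType.
Implicit Types (s r : seq F) (c : F).

Definition cinv_stable s := perm_eq (map cinv s) s.

Lemma cinv_stable_perm s r : perm_eq s r -> cinv_stable s = cinv_stable r.
Proof.
by move=> sr; rewrite /cinv_stable (permPl (perm_map _ sr)) (permPr sr).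
Qed.

Lemma cinv_stable_mem s c : cinv_stable s -> (cinv c \in s) = (c \in s).
Proof.
by move=> /perm_mem <-; rewrite (mem_map (@cinv_inj F)).
Qed.

Lemma cinv_stable_count s c : cinv_stable s -> count_mem (cinv c) s = count_mem c s.
Proof.
move=> /permP st; rewrite -st count_map; apply: eq_count => x /=.
by rewrite (inj_eq (@cinv_inj F)).
Qed.

Lemma cinv_stable_catl s r : cinv_stable (s ++ r) -> cinv_stable s -> cinv_stable r.
Proof.
rewrite /cinv_stable map_cat => /permP H /permP Hs.
by apply/permP => x; apply: (@addnI (count x s)); rewrite -{1}Hs -!count_cat H.
Qed.

Lemma cinv_stable_catr s r : cinv_stable (s ++ r) -> cinv_stable r -> cinv_stable s.
Proof.
rewrite /cinv_stable map_cat => /permP H /permP Hs.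
by apply/permP => x; apply: (@addIn (count x r)); rewrite -{1}Hs -!count_cat H.
Qed.

Lemma cinv_stable_uniq s : uniq s -> {in s, forall c, cinv c \in s} -> cinv_stable s.
Proof.
move=> us H; apply: uniq_perm => //; first by rewrite (map_inj_uniq (@cinv_inj F)).
have sub : {subset map cinv s <= s} by move=> x /mapP[y ys ->]; apply: H.
have um : uniq (map cinv s) by rewrite (map_inj_uniq (@cinv_inj F)).
by case: (uniq_min_size um sub); rewrite ?size_map.
Qed.

Lemma cinv_fixed c : c != 0 -> cinv c = c -> c^* * c = 1.
Proof.
by move=> c0; rewrite /cinv => {2}<-; rewrite divff // conjC_eq0.
Qed.

Lemma roots_unitmx n (A : 'M[F]_n) s c : A \in unitmx ->
  char_poly A = \prod_(z <- s) ('X - z%:P) -> c \in s -> c != 0.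
Proof.
move=> Au As cs; apply: contraTneq Au => c0.
have : root (char_poly A) 0 by rewrite As root_prod_XsubC -c0.
rewrite /root horner_coef0 char_poly_det mulf_eq0 signr_eq0 /= => detA.
by rewrite unitmxE unitfE negbK.
Qed.

Lemma conj_isometry_scalar_stable n (A : 'M[F]_n) s : A \in unitmx -> is_scalar_mx A ->
    char_poly A = \prod_(z <- s) ('X - z%:P) -> cinv_stable s ->
  conj_isometry A.
Proof.
move=> Au /is_scalar_mxP [c Ac] As st.
case: n A Au Ac As => [|n] A Au Ac As.
  by exists 1%:M; [exact: unitmx1 | rewrite [LHS]flatmx0 [RHS]flatmx0].
have sE : perm_eq (nseq n.+1 c) s.
  apply: prod_XsubC_eq; rewrite -As Ac char_poly_trig ?scalar_mx_is_trig //.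
  under [RHS]eq_bigr => i _ do rewrite mxE eqxx mulr1n.
  by rewrite big_nseq big_const_ord.
have cs : c \in s by rewrite -(perm_mem sE) mem_nseq eqxx.
rewrite Ac; apply/conj_isometry_scalar/cinv_fixed; first exact: roots_unitmx Au As cs.
by move: cs; rewrite -(cinv_stable_mem _ st) -(perm_mem sE) mem_nseq => /eqP.
Qed.

Lemma conj_isometry_cyclic_stable n (A : 'M[F]_n.+1) s : A \in unitmx ->
    mxminpoly A = char_poly A ->
    char_poly A = \prod_(z <- s) ('X - z%:P) -> cinv_stable s ->
  conj_isometry A.
Proof.
move=> Au mA As st; apply: conj_isometry_cyclic => //.
by rewrite (char_poly_conj_inv Au As) As; apply: perm_big.
Qed.

(** In dimension at most 2, a matrix is either scalar or cyclic. *)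
Lemma conj_isometry_small n (A : 'M[F]_n) s : (n <= 2)%N -> A \in unitmx ->
    char_poly A = \prod_(z <- s) ('X - z%:P) -> cinv_stable s ->
  conj_isometry A.
Proof.
move=> n2 Au As st.
have [sc|nsc] := boolP (is_scalar_mx A).
  exact: conj_isometry_scalar_stable Au sc As st.
case: n A n2 Au As nsc => [|n] A n2 Au As nsc.
  by case/negP: nsc; apply/is_scalar_mxP; exists 0; rewrite [LHS]flatmx0 [RHS]flatmx0.
move: nsc; rewrite -mxminpoly_linear_is_scalar -ltnNge => sm.
apply: conj_isometry_cyclic_stable As st => //; apply: mxminpoly_eq_char.
by rewrite size_mxminpoly; apply: leq_ltn_trans sm.
Qed.

Lemma conj_isometry_dichotomy (A : 'M[F]_4) s : A \in unitmx ->
    char_poly A = \prod_(z <- s) ('X - z%:P) -> cinv_stable s ->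
  conj_isometry A \/
  exists c, [/\ size (mxminpoly A) = 4, cinv c != c &
                perm_eq s [:: c; c; cinv c; cinv c]].
Proof.
move=> Au As st.
have [d [e [C [A' [P [de Pf PA cC mC]]]]]] := cyclic_decomposition A.
have [r Cr] := closed_field_poly_normal (char_poly C).
have [r' Ar'] := closed_field_poly_normal (char_poly A').
rewrite (monicP (char_poly_monic _)) scale1r in Cr.
rewrite (monicP (char_poly_monic _)) scale1r in Ar'.
have size_roots k (M : 'M[F]_k) t : char_poly M = \prod_(z <- t) ('X - z%:P) -> size t = k.
  by move=> Mt; apply/eqP; rewrite -eqSS -(size_prod_XsubC t id) -Mt size_char_poly.
have sr := size_roots _ _ _ Cr; have sr' := size_roots _ _ _ Ar'.
have srr : perm_eq s (r ++ r') /\ (C \in unitmx) && (A' \in unitmx).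
  rewrite -block_diag_mx_unit; have [uD cD] := similar_unit_char de Pf PA.
  rewrite uD Au; split=> //; apply: prod_XsubC_eq; rewrite -As -cD big_cat -Cr -Ar' /=.
  by rewrite /char_poly char_block_diag_mx det_ublock.
have [{}srr /andP[Cu A'u]] := srr.
(* As a set, the roots of the cyclic block are all roots of [A], hence [cinv]-stable; only their
   multiplicities may fail to be. *)
have mem_r c : (c \in r) = (c \in s).
  rewrite -!root_prod_XsubC -Cr -As cC; exact: root_mxminpoly.
have st' : cinv_stable (r ++ r') by rewrite -(cinv_stable_perm srr).
(* For [e >= 3] the cyclic block is 1x1, so the minimal polynomial is linear and [A] is scalar. *)
have [e3|e2] := ltnP 2 e.
  left; apply: conj_isometry_scalar_stable As st => //.
  rewrite -mxminpoly_linear_is_scalar -ltnS -size_mxminpoly -cC size_char_poly.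
  by lia.
suff [str|[c bad]] : cinv_stable r \/ exists c,
    [/\ size (mxminpoly A) = 4, cinv c != c & perm_eq s [:: c; c; cinv c; cinv c]].
- left; apply: conj_isometry_similar de Pf PA _; apply: conj_isometry_block.
    by apply: conj_isometry_cyclic_stable Cr str; rewrite // cC mC.
  by apply: conj_isometry_small Ar' _ => //; apply: cinv_stable_catl st' str.
- by right; exists c.
have rs c : c \in r -> cinv c \in r.
  by rewrite !mem_r cinv_stable_mem.
have [d1|[d2|d3]] : d = 1%N \/ d = 2%N \/ d = 3%N by lia.
- left; rewrite d1 in sr.
  case: r sr rs {Cr srr mem_r st'} => [|a [|b []]] // _ rs.
  have [ab|ab] := eqVneq a b; last first.
    by apply: cinv_stable_uniq => [|c]; [rewrite /= inE ab | apply: rs].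
  subst b; have := rs a (mem_head _ _); rewrite !inE orbb => /eqP aa.
  by rewrite /cinv_stable /= aa.
- have e1 : e = 1%N by lia.
  rewrite e1 in sr'; rewrite d2 in sr.
  case: r' sr' srr st' {Ar'} => [|c []] // _ srr st'.
  have [cc|cc] := eqVneq (cinv c) c.
    by left; apply: cinv_stable_catr st' _; rewrite /cinv_stable /= cc.
  right; exists c; split=> //; first by rewrite -cC size_char_poly d2.
  have cr : c \in r by rewrite mem_r (perm_mem srr) mem_cat mem_head orbT.
  have pr := perm_to_rem cr.
  have : cinv c \in r by apply: rs.
  rewrite (perm_mem pr) inE (negPf cc) /= => c'r.
  have {}pr : perm_eq r [:: c, cinv c & rem (cinv c) (rem c r)].
    by apply: perm_trans pr _; rewrite perm_cons perm_to_rem.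
  have := perm_size pr; rewrite sr /=.
  case: (rem _ _) pr => [|a []] // pr _.
  have pp : perm_eq s [:: c; c; cinv c; a].
    rewrite (perm_trans srr) // (perm_trans (perm_cat pr (perm_refl _))) //.
    by rewrite (perm_catC _ [:: c]).
  (* In [[c; c; cinv c; a]] the multiplicities of [c] and [cinv c] agree only if [a = cinv c]. *)
  have := cinv_stable_count c st; rewrite !(permP pp) /= !eqxx.
  rewrite (negPf cc) [c == cinv c]eq_sym (negPf cc).
  have [ac|_] := eqVneq a (cinv c); first by rewrite ac in pp.
  by case: (a == c).
- left; apply: cinv_stable_catr st' _.
  have e0 : e = 0%N by lia.
  by rewrite e0 in sr'; rewrite (size0nil sr').
Qed.

End Conjugate.

(** * Quartics with constant term 1 *)

Definition quartic (R : nzRingType) (c1 c2 c3 : R) : {poly R} :=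
  'X^4 - c3 *: 'X^3 + c2 *: 'X^2 - c1 *: 'X + 1.

Lemma prod_quartic (R : comNzRingType) (a b c d : R) : a * b * c * d = 1 ->
  \prod_(z <- [:: a; b; c; d]) ('X - z%:P) =
  quartic (a * b * c + a * b * d + a * c * d + b * c * d)
    (a * b + a * c + a * d + b * c + b * d + c * d) (a + b + c + d).
Proof.
move=> /(congr1 (@polyC R)); rewrite !polyCM => e4.
rewrite !big_cons big_nil /quartic -!mul_polyC !polyCD !polyCM -[X in _ = _ + X]e4; ring.
Qed.

Lemma quartic_inj (R : nzRingType) (c1 c2 c3 d1 d2 d3 : R) :
  quartic c1 c2 c3 = quartic d1 d2 d3 -> [/\ c1 = d1, c2 = d2 & c3 = d3].
Proof.
move=> /polyP E.
have := E 1%N; have := E 2%N; have := E 3%N.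
rewrite /quartic !coefE /= !(mulr0, mulr1, subr0, add0r, addr0, sub0r, oppr0).
by move=> /oppr_inj -> -> /oppr_inj ->.
Qed.

Lemma quartic_roots (F : closedFieldType) (c1 c2 c3 : F) (s : seq F) :
    quartic c1 c2 c3 = \prod_(z <- s) ('X - z%:P) ->
  exists a b c d, [/\ s = [:: a; b; c; d], a * b * c * d = 1,
    c1 = a * b * c + a * b * d + a * c * d + b * c * d,
    c2 = a * b + a * c + a * d + b * c + b * d + c * d & c3 = a + b + c + d].
Proof.
move=> E; have s4 : size s = 4.
  apply/eqP; rewrite -eqSS -(size_prod_XsubC s id) -E /quartic.
  rewrite -!addrA size_polyDl size_polyXn //.
  apply/leq_sizeP => j j4; rewrite !coefE.
  by do 5 (case: j j4 => [|j] j4 //=); rewrite !(mulr0, addr0, subr0, oppr0).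
case: s s4 E => [|a [|b [|c [|d []]]]] // _ E.
have e4 : a * b * c * d = 1.
  have := congr1 (fun p : {poly F} => p.[0]) E.
  rewrite /quartic !big_cons big_nil !hornerE /= => E0.
  have -> : a * b * c * d = - a * - b * - c * - d * 1 by ring.
  by rewrite -E0 expr0n !(mulr0, mul0r, subr0, addr0, add0r, sub0r, oppr0).
by exists a, b, c, d; move: E; rewrite prod_quartic //; move=> /quartic_inj [-> -> ->].
Qed.

(** As [a b c d = 1], the reflection of a root is the conjugate of the product of the other three.
    Reflecting all roots therefore conjugates [c2] and conjugates and swaps [c1] and [c3]. *)
Lemma cinv_stable_quartic (F : numClosedFieldType) (c1 c2 c3 : F) (s : seq F) :
    quartic c1 c2 c3 = \prod_(z <- s) ('X - z%:P) ->
  cinv_stable s <-> c3 = c1^* /\ c2 \is Num.real.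
Proof.
move=> E; have [a [b [c [d [sE e4 E1 E2 E3]]]]] := quartic_roots E.
have e4c : a^* * b^* * c^* * d^* = 1 by rewrite -!rmorphM e4 rmorph1.
have /and4P[a0 b0 c0 d0] : [&& a^* != 0, b^* != 0, c^* != 0 & d^* != 0].
  by have := oner_neq0 F; rewrite -e4c !mulf_eq0 !negb_or -!andbA.
have cE : \prod_(z <- map cinv s) ('X - z%:P) = quartic c3^* c2^* c1^*.
  rewrite sE /= prod_quartic; last by rewrite /cinv -!invfM e4c invr1.
  have -> : cinv a = b^* * c^* * d^* by apply: (mulfI a0); rewrite mulfV // !mulrA.
  have -> : cinv b = a^* * c^* * d^*.
    by apply: (mulfI b0); rewrite mulfV // !mulrA [b^* * _]mulrC.
  have -> : cinv c = a^* * b^* * d^*.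
    by apply: (mulfI c0); rewrite mulfV // -e4c; ring.
  have -> : cinv d = a^* * b^* * c^* by apply: (mulIf d0); rewrite mulVf.
  rewrite E1 E2 E3 !rmorphD !rmorphM /=; congr quartic.
  (* The two sides have degrees 9 and 3 - 2 = 1 in the roots; multiplying by the square of the
     product of the roots evens them out. *)
  - rewrite -[RHS]mul1r -(expr1n F 2) -e4c; ring.
  - rewrite -[RHS]mul1r -e4c; ring.
  - ring.
split=> [st|[c31 /CrealP c2r]].
  have : quartic c1 c2 c3 = quartic c3^* c2^* c1^*.
    by rewrite E -cE; apply/esym/perm_big.
  by move/quartic_inj => [_ /esym/CrealP ? ?].
by apply: prod_XsubC_eq; rewrite -E cE c2r c31 conjCK.
Qed.

(** * The minimal polynomial as an obstruction *)

Lemma conj_isometry_horner (F : numClosedFieldType) (n : nat) (A h : 'M[F]_n.+1) (t : seq F) :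
    map_mx Num.conj A *m h *m A = h -> all (fun z => z != 0) t ->
  exists2 k : F, k != 0 &
    horner_mx (map_mx Num.conj A) (\prod_(z <- t) ('X - (z^*)%:P)) *m h *m A ^+ size t =
    k *: (h *m horner_mx A (\prod_(z <- map cinv t) ('X - z%:P))).
Proof.
move=> hA; elim: t => [|z t IHt] /=.
  by exists 1; rewrite ?oner_eq0 // !big_nil !rmorph1 mul1mx !mulmx1 scale1r.
case/andP=> z0 /IHt [k k0 E]; exists (- z^* * k).
  by rewrite mulf_neq0 // oppr_eq0 conjC_eq0.
set Y := horner_mx (map_mx _ _) _ in E; set H := horner_mx A _ in E.
rewrite /= !big_cons !rmorphM /= -/H -/Y !rmorphB /= !horner_mx_X !horner_mx_C.
set B := map_mx _ _ in hA *.
have -> : (B - (z^*)%:M) * Y *m h *m A ^+ (size t).+1 =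
          (B - (z^*)%:M) *m (Y *m h *m A ^+ size t) *m A.
  by rewrite exprSr !mulmxA.
have HA : H *m A = A *m H by apply: comm_horner_mx.
rewrite E -scalemxAr -scalemxAl mulrC -scalerA; congr (_ *: _).
rewrite -!mulmxA HA !mulmxA -[X in _ = _ *: X]mulmxA [X in _ = _ *: X]mulmxA scalemxAl.
congr (_ *m _).
rewrite !mulmxBl mulmxBr hA !mul_scalar_mx !mul_mx_scalar scalerBr scalerA scaleNr.
by rewrite mulNr divff ?conjC_eq0 // scaleN1r opprK addrC -scalemxAl.
Qed.

(** With [t] the roots of the minimal polynomial, the left side of the crossing identity vanishes,
    so the reflected polynomial kills [A]; having the same degree, it is the minimal polynomial. *)
Lemma conj_isometry_mxminpoly (F : numClosedFieldType) (n : nat) (A : 'M[F]_n.+1) (t : seq F) :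
    A \in unitmx -> conj_isometry A ->
    mxminpoly A = \prod_(z <- t) ('X - z%:P) ->
  cinv_stable t.
Proof.
move=> Au [h hu hA] At.
have t0 : all (fun z => z != 0) t.
  apply/allP => z zt; have [s As] := closed_field_poly_normal (char_poly A).
  rewrite (monicP (char_poly_monic _)) scale1r in As.
  apply: (roots_unitmx Au As) => //.
  by rewrite -root_prod_XsubC -As -root_mxminpoly At root_prod_XsubC.
have [k k0] := conj_isometry_horner hA t0.
have -> : horner_mx (map_mx Num.conj A) (\prod_(z <- t) ('X - (z^*)%:P)) = 0.
  have -> : \prod_(z <- t) ('X - (z^*)%:P) = map_poly Num.conj (mxminpoly A).
    rewrite At rmorph_prod; apply: eq_bigr => z _.
    by rewrite rmorphB /= map_polyX map_polyC.
  by rewrite -map_horner_mx mx_root_minpoly map_mx0.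
rewrite !mul0mx => /esym/eqP; rewrite scaler_eq0 (negPf k0) /= => /eqP hq.
have {hq} : horner_mx A (\prod_(z <- map cinv t) ('X - z%:P)) = 0.
  by apply: (can_inj (mulKmx hu)); rewrite hq mulmx0.
move/eqP; rewrite -dvd_mxminpoly => dv; apply: prod_XsubC_eq; apply/esym/eqP.
rewrite -eqp_monic ?monic_prod_XsubC // -At.
by rewrite -dvdp_size_eqp // At !size_prod_XsubC size_map.
Qed.

(** A minimal polynomial of degree 3 omits one of the four roots, leaving [c] and [cinv c] with
    different multiplicities, against stability. *)
Lemma conj_isometry_balanced (F : numClosedFieldType) (A : 'M[F]_4) (c : F) :
    A \in unitmx -> conj_isometry A -> cinv c != c ->
    char_poly A = \prod_(z <- [:: c; c; cinv c; cinv c]) ('X - z%:P) ->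
  size (mxminpoly A) <> 4.
Proof.
move=> Au Ai cc Ac sm.
have [q qE] := dvdpP _ _ (mxminpoly_dvd_char A).
have [t mt] := closed_field_poly_normal (mxminpoly A).
rewrite (monicP (mxminpoly_monic A)) scale1r in mt.
have [u qu] := closed_field_poly_normal q.
have q1 : lead_coef q = 1.
  have := monicP (char_poly_monic A).
  by rewrite qE lead_coefM (monicP (mxminpoly_monic A)) mulr1.
rewrite q1 scale1r in qu.
have p : perm_eq [:: c; c; cinv c; cinv c] (u ++ t).
  by apply: prod_XsubC_eq; rewrite -Ac qE big_cat -qu -mt.
have st : size t = 3.
  by apply/eqP; rewrite -eqSS -(size_prod_XsubC t id) -mt sm.
have [a ua] : exists a, u = [:: a].
  have : size u = 1%N by move: (perm_size p); rewrite size_cat st /=; lia.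
  by case: (u) => [|a []] // _; exists a.
have pc x : count x [:: c; c; cinv c; cinv c] = count x (a :: t).
  by rewrite (permP p) ua.
have := cinv_stable_count c (conj_isometry_mxminpoly Au Ai mt).
have := pc (pred1 c); have := pc (pred1 (cinv c)).
have := pc (predU1 c (pred1 (cinv c))).
rewrite /= !eqxx (negPf cc) eq_sym (negPf cc) !orbT /=.
case: (eqVneq a c) => [->|_]; first by rewrite eq_sym (negPf cc); lia.
case: (eqVneq a (cinv c)) => [_|_]; first by lia.
(* If [a] were neither [c] nor [cinv c], all four roots would lie in [t], which has three
   entries. *)
have := count_size (predU1 c (pred1 (cinv c))) t; rewrite st /=; lia.
Qed.

(** * Quartics with two double roots *)

(** For these coefficients the quartic is the square of [X^2 - (c3/2) X + e], whose roots are [c]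
    and [d]. *)
Lemma quartic_double_roots (F : numClosedFieldType) (e c3 : F) :
    e ^+ 2 = 1 -> e \is Num.real -> c3^* = e * c3 ->
  exists c d : F, [/\ c * d = e, c3 = 2%:R * (c + d),
    quartic c3^* (c3 ^+ 2 / 4%:R + 2%:R * e) c3 =
      \prod_(z <- [:: c; c; d; d]) ('X - z%:P) &
    `|c| = 1 /\ `|d| = 1 \/ d = cinv c /\ cinv c != c].
Proof.
move=> e2 er c3e.
have e0 : e != 0 by apply/eqP => e0; move/eqP: e2; rewrite e0 expr0n eq_sym oner_eq0.
have eu : `|e| = 1.
  by apply/eqP; rewrite -(@pexpr_eq1 _ _ 2) // -normrX e2 normr1.
have ec : e^* = e by apply/CrealP.
pose D := sqrtC ((c3 / 4%:R) ^+ 2 - e).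
pose c := c3 / 4%:R + D; pose d := c3 / 4%:R - D.
have DD : D ^+ 2 = (c3 / 4%:R) ^+ 2 - e by apply: sqrtCK.
have cd : c * d = e.
  have -> : c * d = (c3 / 4%:R) ^+ 2 - D ^+ 2 by rewrite /c /d; ring.
  by rewrite DD; ring.
have cd3 : c3 = 2%:R * (c + d) by rewrite /c /d; field.
clearbody c d.
have c0 : c != 0 by apply: contraNneq e0 => c0; rewrite -cd c0 mul0r.
have d0 : d != 0 by apply: contraNneq e0 => d0; rewrite -cd d0 mulr0.
exists c, d; split=> //.
  rewrite prod_quartic; last by rewrite -e2 -cd; ring.
  rewrite c3e; congr quartic.
  - by rewrite cd3 -{1}cd; ring.
  - by rewrite cd3 -cd; field.
  - by rewrite cd3; ring.
have dE : d = e / c by rewrite -cd mulrC mulKf.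
have [cc1|cc1] := eqVneq (c * c^*) 1.
  left; have c1 : `|c| = 1.
    by apply/eqP; rewrite -(@pexpr_eq1 _ _ 2) // normCK cc1.
  by split=> //; rewrite dE normrM normfV c1 eu invr1 mulr1.
right; have cc0 : c^* != 0 by rewrite conjC_eq0.
have ccE : c^* = e * c.
  (* This is [(c + d)^* = e (c + d)] with [d = e / c]. Cleared of denominators it factors as
     [(c^* - e c)(c c^* - 1) = 0]. *)
  have E : c^* + e / c^* = e * c + e * e / c.
    have h2 : (2%:R : F) != 0 by rewrite pnatr_eq0.
    have dc : d^* = e / c^* by rewrite dE rmorphM fmorphV /= ec.
    have {dc} <- : c^* + d^* = c^* + e / c^* by rewrite dc.
    have -> : e * c + e * e / c = e * (c + d) by rewrite dE; ring.
    apply: (mulfI h2); rewrite mulrCA -cd3 -c3e cd3.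
    by rewrite rmorphM /= conjC_nat rmorphD.
  have e21 : e * e = 1 by rewrite -expr2.
  have : (c^* - e * c) * (c * c^* - 1) = 0.
    have -> : (c^* - e * c) * (c * c^* - 1) =
       c * c^* * ((c^* + e / c^*) - (e * c + e * e / c)) + (e * e - 1) * c^*.
      by field; rewrite c0 cc0.
    by rewrite E e21 !subrr mulr0 mul0r addr0.
  by move/eqP; rewrite mulf_eq0 [_ - 1 == 0]subr_eq0 (negPf cc1) orbF subr_eq0 => /eqP.
have ei : e^-1 = e by apply: (mulIf e0); rewrite mulVf // -expr2 e2.
have dc : d = cinv c by rewrite dE /cinv ccE invfM ei.
split=> //; apply: contraNneq cc1 => E.
by rewrite -[X in X * _]E /cinv mulVf.
Qed.

(** * Reversibility, reciprocity and trace growth over [C] *)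

Lemma c_reversibleP (n : nat) (A : 'M[C]_n.+1) :
  A \in unitmx -> c_reversible A <-> conj_isometry A.
Proof.
move=> Au; have cu : conj_mx A \in unitmx by rewrite map_unitmx.
split=> [[h [h1 hA]]|[h hu hA]].
  have hu : h \in unitmx by rewrite unitmxE h1 unitr1.
  exists h => //; rewrite -mulmxA; apply: (canLR (mulKVmx cu)).
  by rewrite -hA mulmxKV.
have d0 : \det h != 0 by rewrite -unitfE -unitmxE.
(* Scaling [h] by [k] preserves the intertwining relation and normalizes the determinant to 1. *)
pose k := n.+1.-root (\det h)^-1.
have kE : k ^+ n.+1 = (\det h)^-1 by apply: rootCK.
exists (k *: h); split; first by rewrite detZ kE mulVf.
have ku : k *: h \in unitmx by rewrite unitmxE detZ kE mulVf ?unitr1.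
apply: (canLR (mulmxK ku)); apply: (canRL (mulKmx cu)).
by rewrite -scalemxAl -scalemxAr mulmxA hA.
Qed.

Lemma c_reciprocal_stable (s : seq C) :
  c_reciprocal (\prod_(z <- s) ('X - z%:P)) -> cinv_stable s.
Proof.
move=> rec.
have recs z : z \in s -> count_mem (cinv z) s = count_mem z s.
  rewrite -root_prod_XsubC => /rec [_].
  by rewrite -!(mu_prod_XsubC (_ : C)).
have mems z : z \in s -> cinv z \in s.
  by rewrite -[z \in s]root_prod_XsubC => /rec [+ _]; rewrite root_prod_XsubC.
apply/allP => z _ /=; apply/eqP; rewrite count_map.
have -> : count (preim cinv (pred1 z)) s = count_mem (cinv z) s.
  by apply: eq_count => x /=; rewrite (can2_eq (@cinvK _) (@cinvK _)).
have [/recs//|zs] := boolP (z \in s).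
by rewrite !(count_memPn _) //; apply: contra zs => /mems; rewrite cinvK.
Qed.

Lemma trace_powers_bounded_unit (n : nat) (A : 'M[C]_n.+1) (s : seq C) :
    char_poly A = \prod_(z <- s) ('X - z%:P) -> all (fun z => `|z| == 1) s ->
  trace_powers_bounded A.
Proof.
move=> As s1; exists (size s)%:R => k; rewrite (trace_exp k As) rmorph_nat.
apply: le_trans (ler_norm_sum _ _ _) _; rewrite -sum1_size natr_sum.
rewrite big_seq [X in _ <= X]big_seq; apply: ler_sum => z /(allP s1) /eqP z1.
by rewrite normrX z1 expr1n.
Qed.

(** The traces are [2 (c^k + (cinv c)^k)]. As [c] is not on the unit circle, one of the two terms
    grows geometrically while the other stays bounded by 1. *)
Lemma trace_powers_unbounded (A : 'M[C]_4) (c : C) : c != 0 -> cinv c != c ->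
    char_poly A = \prod_(z <- [:: c; c; cinv c; cinv c]) ('X - z%:P) ->
  ~ trace_powers_bounded A.
Proof.
move=> c0 cc Ac [M HM].
have tr k : \tr (A ^+ k) = 2%:R * (c ^+ k + cinv c ^+ k).
  by rewrite (trace_exp k Ac) !big_cons big_nil; ring.
have nc : `|cinv c| = `|c|^-1 by rewrite normfV norm_conjC.
have [a [b [a1 b1 tab]]] : exists a b : C, [/\ 1 < `|a|, `|b| <= 1 &
    forall k, \tr (A ^+ k) = 2%:R * (a ^+ k + b ^+ k)].
  have c0' : 0 < `|c| by rewrite normr_gt0.
  have : `|c| != 1.
    apply: contra cc => /eqP c1; apply/eqP; rewrite /cinv.
    apply: (mulIf (_ : c^* != 0)); first by rewrite conjC_eq0.
    by rewrite mulVf ?conjC_eq0 // -normCK c1 expr1n.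
  rewrite real_neqr_lt ?normr_real ?real1 // => /orP[c1|c1]; last first.
    by exists c, (cinv c); rewrite c1 nc invf_le1 // ltW.
  exists (cinv c), c; rewrite nc invf_gt1 // c1 ltW //; split=> // k.
  by rewrite tr addrC.
pose x := complex.Re `|a|.
have ax : `|a| = x%:C%C by rewrite RRe_real // normr_real.
have x1 : 0 < x - 1 by rewrite subr_gt0 -ltcR -ax.
(* Bernoulli's inequality, which reduces unboundedness to the Archimedean property of the reals. *)
have key k : 1 + k%:R * (x - 1) <= x ^+ k.
  elim: k => [|k IH]; first by rewrite mul0r addr0.
  have xp : 0 <= x by rewrite -subr_ge0; rewrite subr0; rewrite -(subrK 1 x) addr_ge0 // ltW.
  rewrite exprS; apply: le_trans (ler_wpM2l xp IH).
  rewrite -subr_ge0.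
  have -> : x * (1 + k%:R * (x - 1)) - (1 + k.+1%:R * (x - 1)) = k%:R * (x - 1) ^+ 2.
    by rewrite -natr1; ring.
  by rewrite mulr_ge0 ?ler0n // exprn_ge0 // ltW.
have bnd k : k%:R * (x - 1) <= `|M|.
  have : `|a| ^+ k - 1 <= (M%:C)%C.
    apply: le_trans (HM k); rewrite tab normrM normr_nat.
    have H : `|a| ^+ k - 1 <= `|a ^+ k + b ^+ k|.
      rewrite -normrX; apply: le_trans (lerB_normD _ _).
      by rewrite lerB // normrX exprn_ile1.
    have H0 : 0 <= `|a ^+ k + b ^+ k| by [].
    apply: le_trans H _; rewrite mulr_natl mulr2n lerDl //.
  rewrite ax -rmorphXn -(rmorph1 (real_complex _)) -rmorphB lecR => H.
  apply: le_trans (ler_norm M); apply: le_trans H.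
  by rewrite lerBrDl.
have := archi_boundP (divr_ge0 (normr_ge0 M) (ltW x1)).
by rewrite ltr_pdivrMr // ltNge bnd.
Qed.

(** Put [e = c * cinv c]; its square is the product of the roots, so [e] is 1 or -1, and
    [c^* = e c]. If [c3 = 0], then [cinv c = - c], that is [|c|^2 = -1]. *)
Lemma double_cinv_quartic (F : numClosedFieldType) (c1 c2 c3 c : F) :
    quartic c1 c2 c3 = \prod_(z <- [:: c; c; cinv c; cinv c]) ('X - z%:P) ->
  exists e : F, [/\ e = 1 \/ e = -1, c3^* = e * c3,
    c2 = c3 ^+ 2 / 4%:R + 2%:R * e & c3 != 0].
Proof.
move/quartic_roots => [_ [_ [_ [_ [[<- <- <- <-] e1 _ c2E c3E]]]]].
pose e := c * cinv c; have ee : e ^+ 2 = 1 by rewrite -e1 /e; ring.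
have c0 : c != 0.
  by apply: contra_eq_neq e1 => ->; rewrite !mul0r eq_sym oner_neq0.
have cc0 : c^* != 0 by rewrite conjC_eq0.
have ec : e * c^* = c by rewrite /e /cinv mulfVK.
have ce : c^* = e * c by rewrite -{2}ec mulrA -expr2 ee mul1r.
have e11 : e = 1 \/ e = -1.
  by have /eqP := ee; rewrite sqrf_eq1 => /orP[]/eqP ->; [left | right].
have er : e^* = e by case: e11 => ->; rewrite ?rmorphN rmorph1.
have e0 : e != 0 by case: e11 => ->; rewrite ?oppr_eq0 oner_eq0.
have c'e : cinv c = e / c by rewrite /e mulrAC divff ?mul1r.
exists e; split=> //.
- have -> : c3 = 2%:R * (c + e / c) by rewrite c3E -c'e; ring.
  have -> : e * (2%:R * (c + e / c)) = 2%:R * (e * c + e ^+ 2 / c) by ring.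
  rewrite rmorphM /= conjC_nat rmorphD rmorphM fmorphV /= er ce ee invfM mulrA.
  by rewrite divff.
- by rewrite c2E c3E /e; field.
rewrite c3E; apply/eqP => s0.
have : c * c^* = -1.
  have cN : cinv c = - c.
    have h2 : (2%:R : F) != 0 by rewrite pnatr_eq0.
    by apply: (mulfI h2); apply/eqP; rewrite -subr_eq0; apply/eqP; rewrite -s0; ring.
  rewrite ce mulrCA -{2}[c]opprK -cN mulrN -/e.
  by rewrite mulrN -expr2 ee.
move/eqP; rewrite -normCK => /eqP n1.
by have := exprn_ge0 2 (normr_ge0 c); rewrite n1 oppr_ge0 ler10.
Qed.

(** * Assembling the cases of the theorem *)

Theorem theorem1p6 (A : 'M[C]_4) (c1 c2 c3 : C) :
  \det A = 1 ->
  char_poly A = 'X^4 - c3 *: 'X^3 + c2 *: 'X^2 - c1 *: 'X + 1 ->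
  ((c3 <> c1^* \/ c2 \isn't Num.real) -> ~ c_reciprocal (char_poly A)) /\
  (c3 = c1^* -> c2 \is Num.real ->
     (trace_powers_bounded A -> c_reversible A) /\
     (~ trace_powers_bounded A -> (size (mxminpoly A)).-1 <> 3%N ->
        c_reversible A) /\
     (~ trace_powers_bounded A -> (size (mxminpoly A)).-1 = 3%N ->
        ((forall x y : Rdefinitions.R, \tr A = (x +i* y)%C ->
            x <> 0 -> y <> 0 -> c_reversible A) /\
         (\tr A \is Num.real ->
            (c_reversible A <-> c2 <> c3 ^+ 2 / 4%:R + 2%:R)) /\
         ('Re (\tr A) = 0 ->
            (c_reversible A <-> c2 <> c3 ^+ 2 / 4%:R - 2%:R))))).
Proof.
move=> detA charA.
have Au : A \in unitmx by rewrite unitmxE detA unitr1.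
have [s As] := closed_field_poly_normal (char_poly A).
rewrite (monicP (char_poly_monic _)) scale1r in As.
have Qs : quartic c1 c2 c3 = \prod_(z <- s) ('X - z%:P) by rewrite -As charA.
have trA : \tr A = c3.
  have := char_poly_trace A isT; rewrite charA !coefE /=.
  by rewrite !(mulr0, mulr1, subr0, add0r, addr0, sub0r, oppr0) => /oppr_inj.
split=> [H|c31 c2r].
  rewrite As => /c_reciprocal_stable; rewrite (cinv_stable_quartic Qs) => -[E1 E2].
  by case: H => [//|]; rewrite E2.
have st : cinv_stable s by apply/(cinv_stable_quartic Qs).
have revP := c_reversibleP Au.
(* Failure of reversibility forces both unbounded traces and a minimal polynomial of degree 3, which
   settles (1) and (2). *)
have dich : c_reversible A \/ exists c, [/\ ~ trace_powers_bounded A,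
    size (mxminpoly A) = 4 &
    quartic c1 c2 c3 = \prod_(z <- [:: c; c; cinv c; cinv c]) ('X - z%:P)].
  have [/revP|[c [sm cc sE]]] := conj_isometry_dichotomy Au As st; first by left.
  right; exists c; have Ac := As; rewrite (perm_big _ sE) /= in Ac.
  split=> //; last by rewrite Qs (perm_big _ sE).
  apply: (trace_powers_unbounded _ cc Ac).
  by apply: (roots_unitmx Au Ac); rewrite mem_head.
(* The value of [c2] makes the roots [c, c, d, d]. If both are unimodular the traces are bounded;
   otherwise [d = cinv c], and a cubic minimal polynomial excludes reversibility. *)
have obstruction e : e = 1 \/ e = -1 -> c3^* = e * c3 -> ~ trace_powers_bounded A ->
    size (mxminpoly A) = 4 -> c2 = c3 ^+ 2 / 4%:R + 2%:R * e -> ~ c_reversible A.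
  move=> e1 ec ub sm c2E /revP Ai.
  have ee : e ^+ 2 = 1 by case: e1 => ->; rewrite ?sqrrN expr1n.
  have er : e \is Num.real by case: e1 => ->; rewrite ?realN real1.
  have [c [d [_ _ Qcd cd]]] := quartic_double_roots ee er ec.
  have Acd : char_poly A = \prod_(z <- [:: c; c; d; d]) ('X - z%:P).
    by rewrite -Qcd -c2E c31 conjCK charA -c31.
  case: cd => [[c1' d1']|[dE cc]].
    by apply: ub; apply: trace_powers_bounded_unit Acd _; rewrite /= c1' d1' eqxx.
  by subst d; apply: conj_isometry_balanced Au Ai cc Acd sm.
(* Both halves of (3b) at once: [e = 1] for real and [e = -1] for purely imaginary trace. In the
   converse, [c3 != 0] identifies the sign [e'] coming from the roots with [e]. *)
have twist e : e = 1 \/ e = -1 -> c3^* = e * c3 -> ~ trace_powers_bounded A ->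
    size (mxminpoly A) = 4 -> c_reversible A <-> c2 <> c3 ^+ 2 / 4%:R + 2%:R * e.
  move=> e1 ec ub sm; split=> [Ar c2E|c2E].
    exact: obstruction e1 ec ub sm c2E Ar.
  case: dich => // -[c [_ _ /double_cinv_quartic [e' [_ e'c c2E' c30]]]].
  by case: c2E; rewrite c2E'; congr (_ + 2%:R * _); apply: (mulIf c30); rewrite -e'c -ec.
split; first by case: dich => // -[c [ub]].
split; first by case: dich => // -[c [_ ->]].
move=> ub sm4; have sm : size (mxminpoly A) = 4.
  by case: (size _) sm4 => //= k ->.
split; last split.
(* A non-reversible [A] would have trace equal to plus or minus its conjugate, so [y = 0] or
   [x = 0]. *)
- move=> x y trxy x0 y0; case: dich => // -[c [_ _ /double_cinv_quartic [e [e1 ec _ _]]]].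
  rewrite -trA trxy in ec.
  by case: e1 ec => ->; rewrite ?mul1r ?mulN1r => -[];
     [move=> /esym/eqP|move=> /eqP]; rewrite -addr_eq0 -mulr2n mulrn_eq0 => /eqP.
- move=> /CrealP tr; rewrite trA in tr.
  by have := twist 1; rewrite mul1r mulr1; apply=> //; left.
- rewrite ReE => /eqP; rewrite mulf_eq0 invr_eq0 pnatr_eq0 orbF addrC addr_eq0 trA => /eqP tr.
  by have := twist (-1); rewrite mulN1r mulrN1; apply=> //; right.
Qed.
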